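(* Let $H$ be a separable complex Hilbert space and $T$ a power-bounded recurrent bounded operator on $H$. Then $T$ is hyper-recurrent and $\mathrm{Hr}(T)$ is dense in $H$.
   Context: $T$ is power-bounded if $\sup_n\|T^n\|<\infty$. $x$ is recurrent if $T^{\omega_n}x\to x$ for some strictly increasing sequence $(\omega_n)$ of positive integers; $\mathrm{Rec}(T)$ is the set of recurrent vectors and $T$ is recurrent if $\mathrm{Rec}(T)$ is dense. $\mathfrak{C}$ is the set of strictly increasing sequences $\omega$ with $T^{\omega_n}x\to x$ for some $x\ne0$; $\mathfrak{L}(\omega)=\{x:T^{\omega_n}x\to x\}$. $\mathrm{Hr}(T)$ is the set of $x\in\mathrm{Rec}(T)$ such that $\mathfrak{L}(\omega)$ is dense for every $\omega\in\mathfrak{C}$ with $x\in\mathfrak{L}(\omega)$; a recurrent $T$ is hyper-recurrent if $\mathrm{Hr}(T)\ne\emptyset$. *)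

(* Defs.v *)
(* Complex scalars: R[i] (mathcomp-real-closed complex) over R : realType. *)
From mathcomp Require Import all_boot all_order all_algebra.
From mathcomp Require Import all_classical all_reals all_analysis.
From mathcomp Require Export complex.
Import numFieldNormedType.Exports.
Import Order.TTheory GRing.Theory Num.Theory.
Local Open Scope classical_set_scope.
Local Open Scope ring_scope.

Section Defs.
Context {R : realType} {V : normedModType R[i]}.

(* The norm of V is induced by an inner product ip (linear in the first
   argument, conjugate symmetric, with <x,x> = |x|^2). *)
Definition is_inner_product (ip : V -> V -> R[i]) : Prop :=
  (forall (a : R[i]) (x y z : V), ip (a *: x + y) z = a * ip x z + ip y z) /\
  (forall x y : V, ip x y = (ip y x)^*) /\
  (forall x : V, ip x x = `|x| ^+ 2).

(* separable: has a countable dense subset *)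
Definition separable : Prop := exists D : set V, countable D /\ dense D.

(* bounded (= continuous) linear operator: T : {linear V -> V} with continuous T *)
Definition power_bounded (T : V -> V) : Prop :=
  exists M : R[i], forall (n : nat) (x : V), `|iter n T x| <= M * `|x|.

(* strictly increasing sequence of positive integers *)
Definition incr_pos (w : nat -> nat) : Prop := (0 < w 0)%N /\ forall n, (w n < w n.+1)%N.

(* L(w) = { x | T^{w_n} x -> x } *)
Definition Lset (T : V -> V) (w : nat -> nat) : set V :=
  [set x | iter (w n) T x @[n --> \oo] --> x].

Definition Rec (T : V -> V) : set V :=
  [set x | exists w, incr_pos w /\ Lset T w x].

Definition recurrent (T : V -> V) : Prop := dense (Rec T).

(* the set C of sequences *)
Definition Cset (T : V -> V) : set (nat -> nat) :=
  [set w | incr_pos w /\ exists x, x <> 0 /\ Lset T w x].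

Definition Hr (T : V -> V) : set V :=
  [set x | Rec T x /\ forall w, Cset T w -> Lset T w x -> dense (Lset T w)].

Definition hyper_recurrent (T : V -> V) : Prop := recurrent T /\ Hr T !=set0.

End Defs.

(* Main.v *)
(* A recurrent power-bounded operator is an isometry for an equivalent
   inner-product norm: take a Banach limit of <T^n x, T^n y>; recurrence makes
   it bounded below by a multiple of |x|^2.  Write Q for its square norm.

   For a vector y and e > 0, let x track y if, for some d > 0 and all n,
   Q(T^n x - x) < d implies Q(T^n y - y) < e.  The set of such x is open.  It is
   dense: subtract from y its near-projection on the vectors controlled by x,
   which leaves q almost orthogonal to the orbit of x; then Q(T^n x' - x') for
   x' = x + a q is nearly Q(T^n x - x) + a^2 Q(T^n q - q), so that x' tracks
   both parts of y.

   By Baire, a dense set of vectors x tracks every y of a countable dense set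
   for every e, and T^(w_n) x -> x then forces T^(w_n) y -> y for all those y. *)
Require Import Defs.
From mathcomp Require Import all_boot all_order all_algebra.
From mathcomp Require Import all_classical all_reals all_analysis.
From mathcomp Require Import complex ring lra.
Import numFieldNormedType.Exports.
Import Order.TTheory GRing.Theory Num.Theory.
Local Open Scope classical_set_scope.
Local Open Scope ring_scope.
Local Open Scope complex_scope.

(** * Displacements under a linear isometry of a semidefinite form *)

Section Isometry.
Variables (R : realType) (V : lmodType R[i]) (B : V -> V -> R).
Hypothesis BDl : forall u v w, B (u + v) w = B u w + B v w.
Hypothesis BZl : forall (t : R) u v, B (t%:C *: u) v = t * B u v.
Hypothesis BC : forall u v, B u v = B v u.
Hypothesis B_ge0 : forall u, 0 <= B u u.
Variable T : {linear V -> V}.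
Hypothesis BT : forall u v, B (T u) (T v) = B u v.

Local Notation Q u := (B u u).
Local Notation D n u := (iter n T u - u).

Lemma formNl u v : B (- u) v = - B u v.
Proof.
have -> : - u = (-1)%:C *: u by rewrite rmorphN rmorph1 scaleN1r.
by rewrite BZl mulN1r.
Qed.

Lemma formBl u v w : B (u - v) w = B u w - B v w.
Proof. by rewrite BDl formNl. Qed.

Lemma formDr u v w : B w (u + v) = B w u + B w v.
Proof. by rewrite BC BDl !(BC w). Qed.

Lemma formNr u v : B u (- v) = - B u v.
Proof. by rewrite BC formNl BC. Qed.

Lemma formBr u v w : B w (u - v) = B w u - B w v.
Proof. by rewrite formDr formNr. Qed.

Lemma formZr (t : R) u v : B u (t%:C *: v) = t * B u v.
Proof. by rewrite BC BZl (BC u). Qed.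

Definition formE := (BDl, formDr, formNl, formNr, BZl, formZr).

Lemma form_sqrD u v : Q (u + v) = Q u + 2 * B u v + Q v.
Proof. by rewrite !formE (BC v u); ring. Qed.

Lemma form_sqrZ (t : R) u : Q (t%:C *: u) = t ^+ 2 * Q u.
Proof. by rewrite !formE mulrA. Qed.

(** Positivity at t u + v and at t u - v; the free weight [t] stands in for Cauchy-Schwarz and
    avoids square roots. *)
Lemma normr_form_AMGM (t : R) u v : 0 < t ->
  `|B u v| * (2 * t) <= t ^+ 2 * Q u + Q v.
Proof.
move=> t0; have := B_ge0 (t%:C *: u - v); have := B_ge0 (t%:C *: u + v).
rewrite !formE (BC v u) => h1 h2.
by case: (ger0P (B u v)) => _; nra.
Qed.

Lemma form_le2 u v : Q (u + v) <= 2 * (Q u + Q v).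
Proof. have := B_ge0 (u - v); by rewrite !formE (BC v u) => ?; lra. Qed.

Lemma form_le3 u v w : Q (u + v + w) <= 3 * (Q u + Q v + Q w).
Proof.
have := B_ge0 (u - v); have := B_ge0 (u - w); have := B_ge0 (v - w).
rewrite !formE (BC v u) (BC w u) (BC w v) => ? ? ?; lra.
Qed.

Lemma form_iter n u v : B (iter n T u) (iter n T v) = B u v.
Proof. by elim: n => //= n IH; rewrite BT. Qed.

Lemma iter_linB n u v : iter n T (u - v) = iter n T u - iter n T v.
Proof. by elim: n => //= n ->; rewrite linearB. Qed.

Lemma iter_linD n u v : iter n T (u + v) = iter n T u + iter n T v.
Proof. by elim: n => //= n ->; rewrite linearD. Qed.

Lemma iter_linZ n a u : iter n T (a *: u) = a *: iter n T u.
Proof. by elim: n => //= n ->; rewrite linearZ. Qed.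

Lemma form_iter_sub n u : Q (D n u) <= 4 * Q u.
Proof.
have := B_ge0 (iter n T u + u); rewrite !formE (BC u) form_iter => ?; lra.
Qed.

Lemma iter_subD n u v : D n (u + v) = D n u + D n v.
Proof. by rewrite iter_linD opprD addrACA. Qed.

Lemma iter_subZ n a u : D n (a *: u) = a *: D n u.
Proof. by rewrite iter_linZ scalerBr. Qed.

Variable x : V.

(** A real subspace containing the orbit of [x]. It is not known to be closed, so near-minimizers of
    the distance to it replace projections. *)
Definition controlled (p : V) :=
  exists2 C : R, 0 <= C & forall n, Q (D n p) <= C * Q (D n x).

Lemma controlledD p p' : controlled p -> controlled p' -> controlled (p + p').
Proof.
move=> [C C0 h] [C' C'0 h']; exists (2 * (C + C')); first lra.
move=> n; rewrite iter_subD; have := form_le2 (D n p) (D n p').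
by move: (h n) (h' n) => ? ? ?; lra.
Qed.

Lemma controlledZ (t : R) p : controlled p -> controlled (t%:C *: p).
Proof.
move=> [C C0 h]; exists (t ^+ 2 * C); first by rewrite mulr_ge0 ?sqr_ge0.
by move=> n; rewrite iter_subZ form_sqrZ -mulrA ler_wpM2l ?sqr_ge0.
Qed.

Lemma controlled_iter k : controlled (iter k T x).
Proof.
exists 1 => // n; rewrite mul1r.
by rewrite -iterD addnC iterD -iter_linB form_iter.
Qed.

Lemma controlled0 : controlled 0.
Proof.
by have := controlledZ 0 _ (controlled_iter 0); rewrite rmorph0 scale0r.
Qed.

Hypothesis x_rec : forall (e : R) K, 0 < e ->
  exists2 m, (K <= m)%N & Q (D m x) < e.

Section NearMinimizer.
Variables (y p : V) (s : R).
Hypotheses (s_gt0 : 0 < s) (p_contr : controlled p).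
Hypothesis p_min : forall p', controlled p' -> Q (y - p) <= Q (y - p') + s ^+ 2.

(** Compare [p] with p + t z for t = s and t = -s: near-minimality gives 2 t B z q <= t^2 Q z + s^2,
    and a factor s cancels. *)
Lemma near_orthogonal z : controlled z -> `|B z (y - p)| <= s * (1 + Q z).
Proof.
move=> zW; set q := y - p.
have E (t : R) : Q q <= Q q - 2 * t * B z q + t ^+ 2 * Q z + s ^+ 2.
  have := p_min _ (controlledD _ _ p_contr (controlledZ t _ zW)).
  rewrite opprD addrA -/q => /le_trans; apply; clearbody q.
  rewrite !formE (BC q z); lra.
have h1 := E s; have h2 := E (- s).
have : `|B z q| * s <= s * (1 + Q z) * s.
  case: (ger0P (B z q)) => _; nra.
by rewrite ler_pM2r.
Qed.

(** [T] need not be invertible, so recurrence replaces [x] by a nearby T^m x with m >= n; then B(T^m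
    x, T^n q) = B(T^(m-n) x, q), and T^(m-n) x is controlled. *)
Lemma near_orthogonal_iter n : `|B x (iter n T (y - p))| <= s * (1 + Q x).
Proof.
set q := y - p; apply/ler_addgt0Pr => e e0.
have Q1 : 0 < Q q + 1 by have := B_ge0 q; lra.
have t0 : 0 < e / (Q q + 1) by rewrite divr_gt0.
set t := e / _ in t0.
have tQ : t * (Q q + 1) = e by rewrite mulfVK ?gt_eqF.
have [m nm hm] := x_rec (e * t) n (mulr_gt0 e0 t0).
have h1 : `|B (iter m T x) (iter n T q)| <= s * (1 + Q x).
  rewrite -(subnKC nm) iterD form_iter -(form_iter (m - n) x x).
  exact/near_orthogonal/controlled_iter.
(* Since t (Q q + 1) = e, both t^2 Q q and Q (D m x) are at most e t, so this error term is at most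
   e. *)
have h2 := normr_form_AMGM t (iter n T q) (D m x) t0.
rewrite form_iter BC in h2.
have h3 : `|B (D m x) (iter n T q)| <= e.
  rewrite -(ler_pM2r t0); have := B_ge0 q => ?; nra.
have -> : B x (iter n T q) =
    B (iter m T x) (iter n T q) - B (D m x) (iter n T q).
  by rewrite formBl; ring.
exact: le_trans (ler_normB _ _) (lerD h1 h3).
Qed.

(** The cross term 2 a B(D n x, D n q) splits into four products, each at most s (1 + Q x) in
    absolute value; hence the 8. *)
Lemma near_orthogonal_iter_sub n (a : R) : 0 < a ->
  Q (D n x) + a ^+ 2 * Q (D n (y - p)) <=
  Q (D n (x + a%:C *: (y - p))) + 8 * a * (s * (1 + Q x)).
Proof.
move=> a0; have [h1 h2] := (near_orthogonal_iter 0, near_orthogonal_iter n).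
have h3 := near_orthogonal _ (controlled_iter n).
move: h1 h2 h3; rewrite /=; move: (y - p) => q; rewrite !form_iter => h1 h2 h3.
have : `|B (D n x) (D n q)| <= 4 * (s * (1 + Q x)).
  rewrite formBl !formBr form_iter.
  move: h1 h2 h3; rewrite !ler_norml => /andP[? ?] /andP[? ?] /andP[? ?]; lra.
rewrite iter_subD iter_subZ => /ler_normlP[h4 _].
rewrite (form_sqrD (D n x)) form_sqrZ formZr.
nra.
Qed.

End NearMinimizer.

(* The witness [q] is an almost minimal [y - p], hence almost orthogonal to all
   iterates of [x]; the squared displacements of [x] and [q] therefore almost
   add up in that of [x + a q]. The coarser approximation [p0] of [y] is chosen
   first, as the constant by which [x] controls it must not depend on [q]. *)
Lemma perturbation_control (y : V) (e a : R) : 0 < e -> 0 < a ->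
  exists q, exists2 d : R, 0 < d & Q q <= Q y + 1 /\
    forall n, Q (D n (x + a%:C *: q)) < d -> Q (D n y) < e.
Proof.
move=> e0 a0.
pose S := [set Q (y - p) | p in controlled].
have S_inf : has_inf S.
  split; first by exists (Q (y - 0)), 0 => //; exact: controlled0.
  by exists 0 => _ [p _ <-].
have [S_lb S_lt] : (forall p, controlled p -> inf S <= Q (y - p)) /\
    (forall h, 0 < h -> exists2 p, controlled p & Q (y - p) < inf S + h).
  split=> [p pW|h h0]; first by apply: ge_inf; [case: S_inf|exists p].
  by have [_ [p pW <-] ?] := inf_adherent h0 S_inf; exists p.
have S_y : inf S <= Q y by rewrite -(subr0 y) S_lb //; exact: controlled0.
(* In the final sum of three parts, [t] enters as 3 * 4 * 4 t <= 48 e / 200, while each of the other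
   two parts costs at most e / 3. *)
pose t := Num.min 1 (e / 200).
have t0 : 0 < t by rewrite lt_min ltr01 divr_gt0.
have t1 : t <= 1 by rewrite ge_min lexx.
have te : t <= e / 200 by rewrite ge_min lexx orbT.
have [p0 p0W p0_min] := S_lt t t0.
have [C0 C0_ge0 p0C] := p0W.
have a20 : 0 < a ^+ 2 by rewrite exprn_gt0.
(* Ensures 18 k (C0 + 1) <= e and 18 k <= e a^2, and is fixed before [p1]. *)
pose k := e * a ^+ 2 / (18 * (C0 + 1) * (a ^+ 2 + 1)).
have k0 : 0 < k by rewrite divr_gt0 ?mulr_gt0 //; lra.
have kE : k * (18 * (C0 + 1) * (a ^+ 2 + 1)) = e * a ^+ 2.
  by rewrite mulfVK // gt_eqF // !mulr_gt0 //; lra.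
have Qx1 : 0 < 1 + Q x by have := B_ge0 x; lra.
clearbody k.
(* Keeps the cross-term error 8 a s (1 + Q x) at most [k]. *)
pose s := Num.min t (k / (8 * a * (1 + Q x))).
have s0 : 0 < s by rewrite lt_min t0 divr_gt0 // !mulr_gt0.
have st : s <= t by rewrite ge_min lexx.
have sk : 8 * a * (s * (1 + Q x)) <= k.
  have : s <= k / (8 * a * (1 + Q x)) by rewrite ge_min lexx orbT.
  by rewrite ler_pdivlMr ?mulr_gt0 // => ?; lra.
clearbody s t.
have s2t : s ^+ 2 <= t by nra.
have [p1 p1W p1_lt] := S_lt (s ^+ 2) (exprn_gt0 _ s0).
have p1_min p' : controlled p' -> Q (y - p1) <= Q (y - p') + s ^+ 2.
  by move=> /S_lb ?; lra.
exists (y - p1), k => //; split; first by lra.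
move=> n hn.
(* Parallelogram law: the midpoint of [p0] and [p1] is controlled, so two near-minimizers are close
   to each other. *)
have Qr : Q (p1 - p0) <= 4 * t.
  have := S_lb _ (controlledZ (1 / 2) _ (controlledD _ _ p0W p1W)).
  move: p0_min p1_lt; rewrite !formE.
  rewrite (BC p1 y) (BC p0 y) (BC p1 p0) => ? ? ?; lra.
have := near_orthogonal_iter_sub _ _ _ s0 p1W p1_min n _ a0.
set b := Q (D n (y - p1)); set c := Q (D n x) => h.
have b_ge0 : 0 <= b by exact: B_ge0.
have c_ge0 : 0 <= c by exact: B_ge0.
(* Here c + a^2 b < 2 k, which bounds the displacements of [x] and of [y - p1] separately. *)
have hc : c <= 2 * k by nra.
have hb : a ^+ 2 * b <= 2 * k by lra.
have ka : 18 * k * (C0 + 1) <= e.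
  rewrite -(ler_pM2r a20) -kE.
  suff ? : 0 <= k * (18 * (C0 + 1)) by lra.
  by rewrite !mulr_ge0 // ?ltW//; lra.
have kb : 18 * k <= e * a ^+ 2.
  rewrite -kE; suff ? : 0 <= k * (C0 * (a ^+ 2 + 1) + a ^+ 2) by lra.
  by rewrite mulr_ge0 ?addr_ge0 ?mulr_ge0 ?addr_ge0 // ltW.
have be : 9 * b <= e.
  by rewrite -(ler_pM2r a20); lra.
have Cc : C0 * c <= C0 * (2 * k) by rewrite ler_wpM2l.
have yE : D n y = D n p0 + D n (p1 - p0) + D n (y - p1).
  by rewrite -!iter_subD !subrKC.
have := form_le3 (D n p0) (D n (p1 - p0)) (D n (y - p1)).
rewrite -yE -/b; have := p0C n; rewrite -/c.
have := form_iter_sub n (p1 - p0) => ? ? ?.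
lra.
Qed.

End Isometry.

(** * Banach limits from ultrafilters *)

Section BanachLimit.
Variable R : realType.
Implicit Types u v : nat -> R.

Definition bounded_seq u := exists C : R, forall n, `|u n| <= C.

(** For A in a finer filter G, the preimage of A or of its complement is in [F]; the latter would
    put the empty set in G. *)
Lemma fmap_ultra (T U : Type) (f : T -> U) (F : set_system T) :
  UltraFilter F -> UltraFilter (f @ F).
Proof.
move=> FU; split=> [|G GP fG]; first exact: fmap_proper_filter.
rewrite predeqE => A; split=> [GA|]; last exact: fG.
have [//|FnA] := in_ultra_setVsetC (f @^-1` A) FU.
by have /filter_ex[z []] : G (A `&` ~` A) by apply: filterI => //; exact: fG.
Qed.

Lemma ultra_bounded_cvg (F : set_system nat) u :
  UltraFilter F -> bounded_seq u -> cvg (u @ F).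
Proof.
move=> FU [C uC]; have := @segment_compact R (- C) C; rewrite compact_ultra => K.
have [|l [_ ul]] := K (u @ F) (fmap_ultra _ _ u F FU); last by apply/cvg_ex; exists l.
have -> : (u @ F) [set` `[- C, C]] = F setT; last exact: filterT.
congr F; apply/seteqP; split=> // n _.
by rewrite /= in_itv /= -ler_norml.
Qed.

Lemma arithmetic_mean_bound u a b : (forall n, a <= u n <= b) ->
  forall n, a <= arithmetic_mean u n <= b.
Proof.
move=> uab n; rewrite /arithmetic_mean /= ler_pdivlMl ?ltr0n // ler_pdivrMl ?ltr0n //.
have sumE (c : R) : n.+1%:R * c = \sum_(0 <= k < n.+1) c.
  by rewrite sumr_const_nat subn0 mulr_natl.
by rewrite !sumE /series /= !ler_sum// => k _; case/andP: (uab k).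
Qed.

Lemma arithmetic_mean_bounded u : bounded_seq u -> bounded_seq (arithmetic_mean u).
Proof.
move=> [C uC]; exists C => n; rewrite ler_norml.
by apply: arithmetic_mean_bound => k; rewrite -ler_norml.
Qed.

(** Telescoping; for bounded [u] the right side tends to 0, which yields shift invariance. *)
Lemma arithmetic_mean_shift u n :
  arithmetic_mean (u \o succn) n - arithmetic_mean u n = n.+1%:R^-1 * (u n.+1 - u 0%N).
Proof.
rewrite /arithmetic_mean /= -mulrBr; congr (_ * _); rewrite /series /=.
by rewrite [X in _ - X]big_nat_recl // big_nat_recr //=; ring.
Qed.

(* The limit of Cesaro means along a free ultrafilter. *)
Lemma banach_limit : exists L : (nat -> R) -> R, [/\
  forall u v, bounded_seq u -> bounded_seq v -> L (u \+ v) = L u + L v,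
  forall a u, bounded_seq u -> L (a \*o u) = a * L u,
  forall u a b, (forall n, a <= u n <= b) -> a <= L u <= b &
  forall u, bounded_seq u -> L (u \o succn) = L u].
Proof.
have [F [FU ooF]] := ultraFilterLemma (eventually_filter).
have cv u : bounded_seq u -> cvg (arithmetic_mean u @ F).
  by move=> /arithmetic_mean_bounded; exact: ultra_bounded_cvg.
exists (fun u => lim (arithmetic_mean u @ F)); split.
- move=> u v bu bv; rewrite -limD; [|exact: cv..].
  congr (lim (_ @ F)); apply/funext => n.
  by rewrite /arithmetic_mean /= -mulrDr /series /= big_split.
- move=> a u bu; apply: cvg_lim => //.
  rewrite [X in X @ F](_ : _ = cst a \* arithmetic_mean u).
    by apply: cvgM; [exact: cvg_cst|exact: cv].
  apply/funext => n.
  by rewrite /arithmetic_mean /= /series /= -mulr_sumr mulrCA.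
- move=> u a b uab; have /cv uF : bounded_seq u.
    exists (`|a| + `|b|) => n; have /andP[ua ub] := uab n.
    rewrite ler_norml; have := ler_norm b; have := ler_norm (- a); rewrite normrN.
    have := normr_ge0 a; have := normr_ge0 b => ? ? ? ?; lra.
  by rewrite limr_ge ?limr_le //; apply: filterE => n;
    case/andP: (arithmetic_mean_bound _ _ _ uab n).
- move=> u bu; have [C uC] := bu.
  have bSu : bounded_seq (u \o succn) by exists C => n; exact: uC.
  apply/subr0_eq; rewrite -limB; [|exact: cv..].
  apply: cvg_lim => //.
  (* [F] refines the filter at infinity, so the ordinary limit suffices. *)
  set d := (X in X @ F); suff : d @ \oo --> 0 by move=> d0 A /d0; exact: ooF.
  have -> : d = fun n => harmonic n * (u n.+1 - u 0%N).
    by apply/funext => n; exact: arithmetic_mean_shift.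
  apply/norm_cvg0P.
  apply: (@squeeze_cvgr _ _ _ _ (cst 0) (fun n => harmonic n * (2 * C))).
  + apply: filterE => n; rewrite normr_ge0 normrM (@ger0_norm _ (harmonic n)) ?invr_ge0 //.
    rewrite ler_wpM2l ?invr_ge0 //.
    apply: le_trans (ler_normB _ _) _.
    by have := uC n.+1; have := uC 0%N => ? ?; lra.
  + exact: cvg_cst.
  + rewrite -(mul0r (2 * C)); apply: cvgM; [exact: cvg_harmonic|exact: cvg_cst].
Qed.

End BanachLimit.

(** * The norm as a real number, and Baire's theorem *)

Section RealNorm.
Context {R : realType} {V : normedModType R[i]}.
Implicit Types (x y z : V) (A : set V).

(** The norm takes values in [R[i]], all of them real; its real part allows [lra] and [nra]. *)
Definition rnorm x : R := complex.Re `|x|.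

Lemma rnormE x : (rnorm x)%:C = `|x|.
Proof. by rewrite RRe_real // normr_real. Qed.

Lemma rnorm_ge0 x : 0 <= rnorm x.
Proof. by rewrite -lecR rnormE normr_ge0. Qed.

Lemma rnormD x y : rnorm (x + y) <= rnorm x + rnorm y.
Proof. by rewrite -lecR rmorphD /= !rnormE ler_normD. Qed.

Lemma rnorm_distC x y : rnorm (x - y) = rnorm (y - x).
Proof. by rewrite /rnorm distrC. Qed.

Lemma rnorm_distD z x y : rnorm (x - y) <= rnorm (x - z) + rnorm (z - y).
Proof. by have := rnormD (x - z) (z - y); rewrite addrA subrK. Qed.

Lemma rnormZ (t : R) x : rnorm (t%:C *: x) = `|t| * rnorm x.
Proof.
apply: complexI; rewrite rmorphM /= !rnormE normrZ; congr (_ * _).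
by rewrite normc_def /= expr0n addr0 sqrtr_sqr.
Qed.

Lemma gt0_complexE (e : R[i]) : 0 < e -> 0 < complex.Re e /\ e = (complex.Re e)%:C.
Proof.
move=> e0; have eE : e = (complex.Re e)%:C by rewrite RRe_real // gtr0_real.
by split=> //; rewrite -ltcR -eE.
Qed.

Lemma cvg_rnormP (U : Type) (F : set_system U) (f : U -> V) x : Filter F ->
  (f @ F --> x) <-> (forall e : R, 0 < e -> \forall u \near F, rnorm (f u - x) < e).
Proof.
move=> FF; split=> [/cvgrPdist_lt fx e e0|fx].
  have : (0 : R[i]) < e%:C by rewrite ltcR.
  move=> /fx; apply: filterS => u.
  by rewrite -rnormE rnorm_distC ltcR.
apply/cvgrPdist_lt => e /gt0_complexE[e0 ->].
by apply: filterS (fx _ e0) => u; rewrite rnorm_distC -rnormE ltcR.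
Qed.

Lemma nbhs_rnormP x A :
  nbhs x A <-> exists2 e : R, 0 < e & forall z, rnorm (x - z) < e -> A z.
Proof.
split=> [/nbhs_normP[e /= /gt0_complexE[e0 eE] xA]|[e e0 xA]].
  by exists (complex.Re e) => // z xz; apply: xA; rewrite /ball_ /= -rnormE eE ltcR.
apply/nbhs_normP; exists e%:C => /=; first by rewrite ltcR.
by move=> z; rewrite /ball_ /= -rnormE ltcR => /xA.
Qed.

Lemma open_rnormP A : open A <->
  forall x, A x -> exists2 e : R, 0 < e & forall z, rnorm (x - z) < e -> A z.
Proof.
rewrite openE; split=> [oA x /oA|oA x /oA]; first by move/nbhs_rnormP.
by move=> h; apply/nbhs_rnormP.
Qed.

Lemma dense_rnormP A : dense A <->
  forall x (e : R), 0 < e -> exists2 z, A z & rnorm (x - z) < e.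
Proof.
split=> [dA x e e0|dA O [x Ox] /open_rnormP/(_ x Ox)[e e0 xO]]; last first.
  by have [z Az /xO Oz] := dA x e e0; exists z.
have [||z [xz Az]] := dA [set z | rnorm (x - z) < e].
- by exists x; rewrite /= subrr /rnorm normr0.
- apply/open_rnormP => z /= xz; exists (e - rnorm (x - z)); first by rewrite subr_gt0.
  by move=> z' zz'; apply: le_lt_trans (rnorm_distD z _ _) _; rewrite -ltrBrDl.
- by exists z.
Qed.

End RealNorm.

(* [sequences.Baire] covers real scalars only. *)
Lemma Baire_complex (R : realType) (V : completeNormedModType R[i])
    (U : nat -> set V) :
  (forall i, open (U i)) -> (forall i, dense (U i)) -> dense (\bigcap_i U i).
Proof.
move=> oU dU; apply/dense_rnormP => x0 e0 e0_gt0.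
(* One step of the nested closed balls (centre, radius). The guard on the radius makes the relation
   total, as choice requires. *)
pose P (p : nat * V * R) (q : V * R) := 0 < p.2 -> [/\ 0 < q.2, q.2 <= p.2 / 2,
  rnorm (p.1.2 - q.1) + q.2 <= p.2 & forall z, rnorm (q.1 - z) <= q.2 -> U p.1.1 z].
have /choice[g gP] : forall p, exists q, P p q.
  move=> [[n x] r]; rewrite /P /=.
  have [r0|_] := ltP 0 r; last by exists (x, r).
  have r20 : 0 < r / 2 by rewrite divr_gt0.
  have /dense_rnormP/(_ x _ r20)[y Uy xy] := dU n.
  have /open_rnormP/(_ y Uy)[e e_gt0 yU] := oU n.
  have ? : Num.min (e / 2) (r / 2) <= e / 2 by rewrite ge_min lexx.
  have ? : Num.min (e / 2) (r / 2) <= r / 2 by rewrite ge_min lexx orbT.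
  exists (y, Num.min (e / 2) (r / 2)) => _ /=; split=> //.
  - by rewrite lt_min !divr_gt0.
  - by lra.
  - by move=> z yz; apply: yU; lra.
pose f := fix f n := if n is m.+1 then g (m, (f m).1, (f m).2) else (x0, e0 / 2).
pose a n := (f n).1; pose r n := (f n).2.
have r_gt0 n : 0 < r n.
  elim: n => [|n IH]; first by rewrite /r /= divr_gt0.
  by have [] := gP (n, a n, r n) IH.
have fP n : [/\ r n.+1 <= r n / 2, rnorm (a n - a n.+1) + r n.+1 <= r n &
    forall z, rnorm (a n.+1 - z) <= r n.+1 -> U n z].
  by have [_ ? ? ?] := gP (n, a n, r n) (r_gt0 n).
have aD n k : rnorm (a n - a (n + k)%N) + r (n + k)%N <= r n.
  elim: k => [|k IH]; first by rewrite addn0 subrr /rnorm normr0 add0r.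
  rewrite addnS; have [_ h _] := fP (n + k)%N.
  by have := rnorm_distD (a (n + k)%N) (a n) (a (n + k).+1) => ?; lra.
(* The radii halve; the weaker rate e0 / (n + 1) follows from n + 2 <= 2 (n + 1) and is enough by
   the Archimedean property. *)
have r_le n : r n * n.+1%:R <= e0.
  elim: n => [|n IH]; first by rewrite /r /=; lra.
  have [h _ _] := fP n; have := r_gt0 n => rn0.
  have : r n.+1 * n.+2%:R <= r n / 2 * n.+2%:R by rewrite ler_wpM2r.
  suff : r n / 2 * n.+2%:R <= r n * n.+1%:R by move=> ? ?; lra.
  rewrite -mulrA ler_pM2l // -(addn2 n) -(addn1 n) !natrD.
  by have := ler0n R n => ?; lra.
have r_cvg (e : R) : 0 < e -> exists n, r n < e.
  move=> e_gt0; pose n := Num.bound (e0 / e); exists n.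
  have : e0 / e < n%:R by apply: archi_boundP; rewrite divr_ge0 ?ltW.
  rewrite ltr_pdivrMr // => ne; have := r_le n; rewrite -natr1 => ?.
  have := r_gt0 n => ?; have := ler0n R n => ?.
  by rewrite ltNge; apply/negP => ?; nra.
have : cauchy (a @ \oo).
  apply: cauchy_exP => e /gt0_complexE[e_gt0 ->].
  have [n rn] := r_cvg _ e_gt0; exists (a n); exists n => // m /= nm.
  rewrite -ball_normE /= -rnormE ltcR -(subnKC nm).
  have := aD n (m - n)%N; have := r_gt0 (n + (m - n))%N => ? ?; lra.
move=> /cauchy_cvg/cvg_ex[z /= az].
have az_le n : rnorm (a n - z) <= r n.
  apply/ler_addgt0Pr => e e_gt0.
  have /cvg_rnormP/(_ e e_gt0)[k _ kz] := az.
  have := kz (n + k)%N (leq_addl _ _) => /= ?.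
  have := rnorm_distD (a (n + k)%N) (a n) z; have := aD n k.
  by have := r_gt0 (n + k)%N => ? ? ?; lra.
exists z; first by move=> n _; have [_ _] := fP n; apply.
by have := az_le 0%N; rewrite /a /r /= => ?; lra.
Qed.

(** * Recurrence of every vector and the invariant form *)

Section PowerBounded.
Context {R : realType} {H : normedModType R[i]} (T : {linear H -> H}) (M : R).
Hypothesis M_ge1 : 1 <= M.
Hypothesis T_bound : forall n x, rnorm (iter n T x) <= M * rnorm x.

Let M_gt0 : 0 < M.
Proof. exact: lt_le_trans ltr01 M_ge1. Qed.

Lemma RecP x : Rec T x <->
  forall (e : R) K, 0 < e -> exists2 m, (K <= m)%N & rnorm (iter m T x - x) < e.
Proof.
split=> [[w [[w0 wS] wx]] e K e0|xrec].
  have w_ge n : (n <= w n)%N by elim: n => // n /leq_ltn_trans; apply.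
  have /cvg_rnormP/(_ e e0)[N _ wN] := wx.
  exists (w (K + N)%N); last by apply: wN; rewrite /= leq_addl.
  exact: leq_trans (leq_addr _ _) (w_ge _).
(* [g (m, n)] is a return time beyond m with error below 1 / (n + 1); the strict bound also makes
   the first term positive. *)
have /choice[g gP] (p : nat * nat) : exists m, (p.1 < m)%N /\
    rnorm (iter m T x - x) < p.2.+1%:R^-1.
  by have [|m ? ?] := xrec (p.2.+1%:R^-1) p.1.+1; [rewrite invr_gt0|exists m].
pose w := fix w n := if n is m.+1 then g (w m, n) else g (0%N, 0%N).
exists w; split; first by split=> [|n]; [have [] := gP (0, 0)%N|have [] := gP (w n, n.+1)].
have wx n : rnorm (iter (w n) T x - x) < n.+1%:R^-1.
  by case: n => [|n]; [have [] := gP (0, 0)%N|have [] := gP (w n, n.+1)].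
apply/cvg_rnormP => e e0.
have [N _ hN] := near_infty_natSinv_lt (PosNum e0).
by exists N => // n /hN; exact: lt_trans (wx n).
Qed.

Hypothesis T_rec : recurrent T.

(** Power-boundedness makes the set of recurrent vectors closed: a recurrent y within d of [x] gives
    a displacement of at most (M + 2) d = e / 2. *)
Lemma recurrent_all x (e : R) K : 0 < e ->
  exists2 m, (K <= m)%N & rnorm (iter m T x - x) < e.
Proof.
move=> e0; have M20 : 0 < 2 * (M + 2) by rewrite mulr_gt0 ?addr_gt0.
pose d := e / (2 * (M + 2)).
have dE : d * (2 * (M + 2)) = e by rewrite mulfVK // gt_eqF.
have d0 : 0 < d by rewrite divr_gt0.
have /dense_rnormP/(_ x d d0)[y /RecP yrec xy] := T_rec.
have [m Km my] := yrec d K d0; exists m => //.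
have := rnorm_distD (iter m T y) (iter m T x) x.
have := rnorm_distD y (iter m T y) x.
rewrite -iter_linB (rnorm_distC y); have := T_bound m (x - y) => ? ? ?.
have : M * rnorm (x - y) <= M * d by rewrite ler_pM2l // ltW.
by clearbody d; move=> ?; nra.
Qed.

(** [x] is close to some T^m x = T^(m-n) (T^n x) with m >= n. *)
Lemma recurrent_lower_bound n x : rnorm x <= M * rnorm (iter n T x).
Proof.
apply/ler_addgt0Pr => e e0; have [m nm mx] := recurrent_all x e n e0.
have := T_bound (m - n) (iter n T x); rewrite -ssrnat.iterD subnK // => ?.
have := rnormD (iter m T x) (x - iter m T x); rewrite subrKC rnorm_distC => ?.
by lra.
Qed.

(** Shift invariance of the Banach limit becomes invariance under [T]; the two-sided bounds on the
    norms of T^n u pass to the limit. *)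
Lemma invariant_form (ip : H -> H -> R[i]) : is_inner_product ip ->
  exists B : H -> H -> R,
  [/\ forall u v w, B (u + v) w = B u w + B v w,
      forall (t : R) u v, B (t%:C *: u) v = t * B u v,
      forall u v, B u v = B v u,
      forall u v, B (T u) (T v) = B u v &
      forall u, rnorm u ^+ 2 <= M ^+ 2 * B u u /\ B u u <= M ^+ 2 * rnorm u ^+ 2].
Proof.
move=> [ipD [ipC ipN]].
have [L [LD LZ Lle LS]] := banach_limit R.
pose b x y := complex.Re (ip x y).
have bN u : b u u = rnorm u ^+ 2.
  by apply: complexI; rewrite /b ipN -rnormE -rmorphXn.
have bDl u v w : b (u + v) w = b u w + b v w.
  by rewrite /b -(scale1r u) ipD mul1r scale1r; case: (ip u w) (ip v w) => [? ?] [? ?].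
have ip0 w : ip 0 w = 0.
  have := ipD 1 0 0 w; rewrite scale1r mul1r !addr0 => h.
  by apply: (addrI (ip 0 w)); rewrite -h addr0.
have bZl t u w : b (t%:C *: u) w = t * b u w.
  rewrite /b -[_ *: _]addr0 ipD ip0 addr0.
  by case: (ip u w) => ? ? /=; rewrite mul0r subr0.
have bC u v : b u v = b v u by rewrite /b ipC; case: (ip v u).
(* A crude bound, enough to make the sequences [s u v] bounded. *)
have b_bound u v : `|b u v| <= rnorm u ^+ 2 + rnorm v ^+ 2.
  have b0 z : 0 <= b z z by rewrite bN sqr_ge0.
  have /(_ 1 u v ltr01) := normr_form_AMGM R H b bDl bZl bC b0.
  rewrite expr1n mul1r -!bN => ?; have := b0 u; have := b0 v; have := normr_ge0 (b u v).
  by move=> ? ? ?; lra.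
pose s u v n := b (iter n T u) (iter n T v).
have s_bounded u v : bounded_seq R (s u v).
  exists ((M * rnorm u) ^+ 2 + (M * rnorm v) ^+ 2) => n.
  apply: le_trans (b_bound _ _) _.
  by rewrite lerD // ler_sqr ?nnegrE ?mulr_ge0 ?rnorm_ge0 // ltW.
exists (fun u v => L (s u v)); split.
- move=> u v w; rewrite -LD; [|exact: s_bounded..].
  by congr L; apply/funext => n; rewrite /s iter_linD bDl.
- move=> t u v; rewrite -LZ; last exact: s_bounded.
  by congr L; apply/funext => n; rewrite /s iter_linZ bZl.
- by move=> u v; congr L; apply/funext => n; rewrite /s bC.
- move=> u v; rewrite -(LS (s u v)); last exact: s_bounded.
  by congr L; apply/funext => n; rewrite /s /= -!iterSr.
- move=> u; have M20 : 0 < M ^+ 2 by rewrite exprn_gt0.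
  have /andP[lo hi] : rnorm u ^+ 2 / M ^+ 2 <= L (s u u) <= M ^+ 2 * rnorm u ^+ 2.
    apply: Lle => n; rewrite /s bN ler_pdivrMr // mulrC -!exprMn.
    rewrite !ler_sqr ?nnegrE ?mulr_ge0 ?rnorm_ge0 ?(ltW M_gt0) //.
    by rewrite recurrent_lower_bound T_bound.
  by rewrite mulrC -ler_pdivrMr.
Qed.

(** * Vectors whose returns force those of a given vector *)

Section Form.
Variable B : H -> H -> R.
Hypothesis BDl : forall u v w, B (u + v) w = B u w + B v w.
Hypothesis BZl : forall (t : R) u v, B (t%:C *: u) v = t * B u v.
Hypothesis BC : forall u v, B u v = B v u.
Hypothesis BT : forall u v, B (T u) (T v) = B u v.
Hypothesis B_lower : forall u, rnorm u ^+ 2 <= M ^+ 2 * B u u.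
Hypothesis B_upper : forall u, B u u <= M ^+ 2 * rnorm u ^+ 2.

Local Notation Q u := (B u u).
Local Notation D n u := (iter n T u - u).

Let M2_gt0 : 0 < M ^+ 2.
Proof. by rewrite exprn_gt0. Qed.

Let B_ge0 u : 0 <= Q u.
Proof. by rewrite -(pmulr_rge0 _ M2_gt0) (le_trans _ (B_lower u)) ?sqr_ge0. Qed.

Lemma form_small (e : R) : 0 < e ->
  exists2 r : R, 0 < r & forall u, rnorm u < r -> Q u < e.
Proof.
move=> e0; pose r := Num.min 1 (e / M ^+ 2).
have r0 : 0 < r by rewrite lt_min ltr01 divr_gt0.
have r1 : r <= 1 by rewrite ge_min lexx.
have re : M ^+ 2 * r <= e by rewrite mulrC -ler_pdivlMr // ge_min lexx orbT.
exists r => // u ur; apply: le_lt_trans (B_upper u) (lt_le_trans _ re).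
by rewrite ltr_pM2l //; have := rnorm_ge0 u => ?; clearbody r; nra.
Qed.

(** As [d] is uniform in n, the condition serves all sequences of return times at once. *)
Definition tracked (y : H) (e : R) : set H :=
  [set x | exists2 d : R, 0 < d & forall n, Q (D n x) < d -> Q (D n y) < e].

(** Q (D n (x - z)) <= 4 Q (x - z) for all n, so the displacements of a nearby z are uniformly close
    to those of x; 2 (d/4 + 4 d/16) = d. *)
Lemma open_tracked y e : open (tracked y e).
Proof.
apply/open_rnormP => x [d d0 xy].
have [|r r0 rQ] := form_small (d / 16); first by rewrite divr_gt0.
exists r => // z /rQ xz; exists (d / 4); first by rewrite divr_gt0.
move=> n zn; apply: xy.
have := form_le2 _ _ B BDl BZl BC B_ge0 (D n z) (D n (x - z)).
rewrite -iter_subD subrKC.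
have := form_iter_sub _ _ B BDl BZl BC B_ge0 T BT n (x - z) => ? ?; lra.
Qed.

(** The bound Q q <= Q y + 1 does not involve [a], so [a] can be fixed beforehand to make a q
    shorter than the given radius. *)
Lemma dense_tracked y e : 0 < e -> dense (tracked y e).
Proof.
move=> e0; apply/dense_rnormP => x r r0.
have Qy := B_ge0 y.
pose K := M ^+ 2 * (Q y + 1) + 1.
have K0 : 0 < K by rewrite ltr_wpDl // mulr_ge0 ?ltW //; lra.
have a0 : 0 < r / (2 * K) by rewrite divr_gt0 ?mulr_gt0.
set a := r / _ in a0; have aK : a * (2 * K) = r by rewrite mulfVK // gt_eqF ?mulr_gt0.
have x_rec (h : R) N : 0 < h -> exists2 m, (N <= m)%N & Q (D m x) < h.
  move=> /form_small[s s0 sQ].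
  by have [m Nm /sQ] := recurrent_all x s N s0; exists m.
have [q [d d0 [Qq qy]]] :=
  perturbation_control _ _ B BDl BZl BC B_ge0 T BT x x_rec y e a e0 a0.
exists (x + a%:C *: q); first by exists d.
rewrite rnorm_distC addrAC subrr add0r rnormZ gtr0_norm //.
have qK : rnorm q <= K.
  have : M ^+ 2 * Q q <= M ^+ 2 * (Q y + 1) by rewrite ler_pM2l.
  by have := B_lower q; have := sqr_ge0 (rnorm q - 1); rewrite /K => ? ? ?; nra.
have : a * rnorm q <= a * K by rewrite ler_pM2l.
by have := mulr_gt0 a0 K0 => ? ?; lra.
Qed.

Lemma tracked_Lset x y w :
  (forall k, tracked y k.+1%:R^-1 x) -> Lset T w x -> Lset T w y.
Proof.
move=> xy /cvg_rnormP wx; apply/cvg_rnormP => e e0.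
have d0 : 0 < e ^+ 2 / M ^+ 2 by rewrite divr_gt0 ?exprn_gt0.
have [k _ /(_ k (leqnn k)) kd] := near_infty_natSinv_lt (PosNum d0).
have [d /form_small[r /wx wr rQ] dy] := xy k.
apply: filterS wr => n /rQ/dy yn.
rewrite -ltr_sqr ?nnegrE ?rnorm_ge0 ?(ltW e0) //.
apply: le_lt_trans (B_lower _) _; rewrite mulrC -ltr_pdivlMr //.
exact: lt_trans yn kd.
Qed.

End Form.
End PowerBounded.

(** * Baire category over a countable dense set *)

Theorem theorem5p2 (R : realType) (H : completeNormedModType R[i])
  (ip : H -> H -> R[i]) (Hip : is_inner_product ip) (Hsep : @separable R H)
  (T : {linear H -> H}) (Tcont : continuous T)
  (Tpb : power_bounded (T : H -> H)) (Trec : recurrent (T : H -> H)) :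
  hyper_recurrent (T : H -> H) /\ dense (Hr (T : H -> H)).
Proof.
suff dHr : dense (Hr T).
  split=> //; split=> //; have [|x [_ Hx]] := dHr setT _ openT; last by exists x.
  by exists 0.
have [M0 T_bound0] := Tpb.
pose M := Num.max 1 (complex.Re M0).
have M_ge1 : 1 <= M by rewrite le_max lexx.
have T_bound n x : rnorm (iter n T x) <= M * rnorm x.
  have := T_bound0 n x; rewrite -!rnormE lecE => /andP[_ /=].
  rewrite /M; case: (M0) => m m' /=; rewrite mulr0 subr0 => /le_trans; apply.
  by rewrite ler_wpM2r ?rnorm_ge0 // le_max lexx orbT.
have [B [BDl BZl BC BT /all_and2[B_lower B_upper]]] :=
  invariant_form T M M_ge1 T_bound Trec ip Hip.
have [D [cD dD]] := Hsep.
have [D0|[h]] := pfcard_geP cD.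
  by have [|x []] := dD setT _ openT; [exists 0|rewrite D0].
(* Each i codes a target [h j] and a tolerance 1 / (k + 1); an i that codes no pair merely repeats
   the condition for (0, 0). *)
pose U i := let p := odflt (0, 0)%N (unpickle i) in
  tracked T B (h p.1) p.2.+1%:R^-1.
have dU : dense (\bigcap_i U i).
  apply: Baire_complex => i; first exact: open_tracked B_upper _ _.
  by apply: (dense_tracked T M); rewrite // invr_gt0.
move=> O O0 /(dU O O0)[x [Ox xU]]; exists x; split=> //.
split; first exact/RecP/(recurrent_all T M).
(* It suffices that [Lset T w] contains the dense set [D]. *)
move=> w _ wx O' O'0 /(dD O' O'0)[y [Oy Dy]]; exists y; split=> //.
have [j _ jy] := @surj _ _ _ _ h y Dy.
apply: (tracked_Lset T M M_ge1 B) wx => // k.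
by have := xU (pickle (j, k)) I; rewrite /U pickleK /= jy.
Qed.
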